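(* Let $\mathcal H$ be a real Hilbert space and $\Phi=f+g$, where $f:\mathcal H\to\mathbb R$ is continuously Fréchet differentiable and $\mu$-strongly convex for some $\mu\ge0$ with $\nabla f$ $L$-Lipschitz continuous ($L>0$, $\mu<L$), $g:\mathcal H\to(-\infty,+\infty]$ is proper, lower semicontinuous and convex, and $\operatorname{argmin}\Phi\neq\varnothing$. Let $0<s\le1/L$, fix $x^*\in\operatorname{argmin}\Phi$ and $\Phi^*=\Phi(x^* )$. Let $\{\theta_k\}_{k\ge1}$ be positive numbers such that, for every $k\ge1$, $$\theta_k\ge\sqrt s,\qquad\mu\theta_k^2\le1,\qquad\bigl(1-\sqrt s\,\mu\theta_{k+1}\bigr)\theta_k^2\ge\left(1-\frac{\sqrt s}{\theta_{k+1}}\right)\theta_{k+1}^2 .$$ Let the iterates $(x_k,y_k,z_k)$ be generated by either the one-sequence scheme or the two-sequence scheme (both defined in the context) with this $\{\theta_k\}$. Then the energy sequence $$\mathcal E_k=A_k\bigl(\Phi(x_k)-\Phi^*\bigr)+\frac{M_k}{2}\|z_k-x^*\|^2,\qquad k\ge1,$$ with $$A_k=\theta_k^2\prod_{i=1}^k\frac1{1-\sqrt s\,\mu\theta_i},\qquad M_k=\prod_{i=1}^k\frac1{1-\sqrt s\,\mu\theta_i},$$ is nonincreasing. Consequently, $$\Phi(x_k)-\Phi^*\le\frac{\mathcal E_1}{A_k},\qquad k\ge1,$$ where $\mathcal E_1=A_1\bigl(\Phi(x_1)-\Phi^*\bigr)+\frac{M_1}{2}\|z_1-x^*\|^2$.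
   Context: Strong convexity: $f(y)\ge f(x)+\langle\nabla f(x),y-x\rangle+\frac\mu2\|y-x\|^2$ for all $x,y\in\mathcal H$. Proximal map: $\operatorname{prox}_{\lambda g}(u)=\operatorname{argmin}_{v\in\mathcal H}\{g(v)+\frac1{2\lambda}\|v-u\|^2\}$, $\lambda>0$. Both schemes are initialized with $x_0=x_1=z_1\in\operatorname{dom}g$ and use, for $k\ge1$, $$\beta_k=\frac{(\theta_k-\sqrt s)\bigl(1-\mu\sqrt s\,\theta_{k+1}\bigr)}{(1-s\mu)\theta_{k+1}},\qquad y_k=x_k+\beta_k(x_k-x_{k-1}).$$ One-sequence scheme: $x_{k+1}=\operatorname{prox}_{sg}\bigl(y_k-s\nabla f(y_k)\bigr)$; the auxiliary sequence is defined by $z_{k+1}=x_k+\frac{\theta_{k+1}}{\sqrt s}(x_{k+1}-x_k)$ for $k\ge1$. Two-sequence scheme: $$z_{k+1}=\operatorname{prox}_{\sqrt s\,\theta_{k+1}g}\Bigl(z_k-\mu\sqrt s\,\theta_{k+1}(z_k-y_k)-\sqrt s\,\theta_{k+1}\nabla f(y_k)\Bigr),\qquad x_{k+1}=\left(1-\frac{\sqrt s}{\theta_{k+1}}\right)x_k+\frac{\sqrt s}{\theta_{k+1}}z_{k+1}.$$ *)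

(* Defs.v *)
From mathcomp Require Export all_boot all_order all_algebra.
From mathcomp Require Export all_classical all_reals all_analysis.
Export Order.TTheory GRing.Theory Num.Theory.
Export numFieldNormedType.Exports.

Set Implicit Arguments.
Unset Strict Implicit.
Unset Printing Implicit Defensive.

Local Open Scope classical_set_scope.
Local Open Scope ring_scope.

(** A real Hilbert space is a [completeNormedModType R] together with a
    positive definite symmetric bilinear form inducing its norm. *)
Definition induces_norm (R : realType) (H : completeNormedModType R)
    (dot : {dot H for idfun}) : Prop :=
  forall x : H, `|x| ^+ 2 = dot x x.

Definition is_gradient (R : realType) (H : completeNormedModType R)
    (dot : {dot H for idfun}) (f : H -> R) (gradf : H -> H) : Prop :=
  forall x : H, differentiable f x /\ forall h : H, 'd f x h = dot (gradf x) h.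

Definition strongly_convex (R : realType) (H : completeNormedModType R)
    (dot : {dot H for idfun}) (mu : R) (f : H -> R) (gradf : H -> H) : Prop :=
  forall x y : H,
    f x + dot (gradf x) (y - x) + mu / 2 * `|y - x| ^+ 2 <= f y.

(** Extended-valued functions [H -> \bar R]; the value -oo is excluded by
    [proper].  Recall that [0 * +oo = 0] in [\bar R], so that [convex_efun]
    holds trivially at [t = 0] and [t = 1]. *)

Definition edom (R : realType) (T : Type) (g : T -> \bar R) : set T :=
  [set x | (g x < +oo)%E].

Definition proper (R : realType) (T : Type) (g : T -> \bar R) : Prop :=
  (forall x, (-oo < g x)%E) /\ edom g !=set0.

Definition convex_efun (R : realType) (V : lmodType R) (g : V -> \bar R) : Prop :=
  forall (x y : V) (t : R), 0 <= t <= 1 ->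
    (g (t *: x + (1 - t) *: y)%R <= t%:E * g x + (1 - t)%:E * g y)%E.

Definition argmin (R : realType) (T : Type) (F : T -> \bar R) : set T :=
  [set x | forall y, (F x <= F y)%E].

(** [prox lambda g u] is the set of minimizers, so [prox lambda g u v] reads
    "v = prox_{lambda g}(u)"; the minimizer is unique for convex proper [g]. *)
Definition prox (R : realType) (H : completeNormedModType R)
    (lambda : R) (g : H -> \bar R) (u : H) : set H :=
  argmin (fun v => (g v + ((2 * lambda)^-1 * `|v - u| ^+ 2)%:E)%E).

Section Schemes.
Context {R : realType} {H : completeNormedModType R}.
Variables (s mu : R) (theta : nat -> R).

Definition beta (k : nat) : R :=
  (theta k - Num.sqrt s) * (1 - mu * Num.sqrt s * theta k.+1)
  / ((1 - s * mu) * theta k.+1).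

(** The sequences are indexed by [nat]; only [x 0], [x k], [y k], [z k] and
    [theta k] with [1 <= k] are meaningful. *)

Definition extrapolation (x y : nat -> H) : Prop :=
  forall k, (1 <= k)%N -> y k = x k + beta k *: (x k - x k.-1).

Definition initialization (g : H -> \bar R) (x z : nat -> H) : Prop :=
  [/\ x 0%N = x 1%N, x 1%N = z 1%N & edom g (z 1%N)].

Definition one_sequence_scheme (g : H -> \bar R) (gradf : H -> H)
    (x y z : nat -> H) : Prop :=
  [/\ initialization g x z, extrapolation x y &
      forall k, (1 <= k)%N ->
        prox s g (y k - s *: gradf (y k)) (x k.+1) /\
        z k.+1 = x k + (theta k.+1 / Num.sqrt s) *: (x k.+1 - x k)].

Definition two_sequence_scheme (g : H -> \bar R) (gradf : H -> H)
    (x y z : nat -> H) : Prop :=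
  [/\ initialization g x z, extrapolation x y &
      forall k, (1 <= k)%N ->
        prox (Num.sqrt s * theta k.+1) g
          (z k - (mu * Num.sqrt s * theta k.+1) *: (z k - y k)
               - (Num.sqrt s * theta k.+1) *: gradf (y k)) (z k.+1) /\
        x k.+1 = (1 - Num.sqrt s / theta k.+1) *: x k
                 + (Num.sqrt s / theta k.+1) *: z k.+1].

Definition Mcoef (k : nat) : R :=
  \prod_(1 <= i < k.+1) (1 - Num.sqrt s * mu * theta i)^-1.

Definition Acoef (k : nat) : R := theta k ^+ 2 * Mcoef k.

Definition energy (Phi : H -> \bar R) (xstar : H) (x z : nat -> H) (k : nat) :
    \bar R :=
  ((Acoef k)%:E * (Phi (x k) - Phi xstar)
   + (Mcoef k / 2 * `|z k - xstar| ^+ 2)%:E)%E.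

End Schemes.

(* Main.v *)
Require Import Defs.
From mathcomp Require Import ring lra.

Set Implicit Arguments.
Unset Strict Implicit.
Unset Printing Implicit Defensive.

Local Open Scope classical_set_scope.
Local Open Scope ring_scope.

(** Let xs be the minimizer, q = sqrt s, t = theta_{k+1}, a = q / t and
    alpha = mu q t.  The two schemes differ only in where the proximal map is
    evaluated; both satisfy

      y_k     = (1 - a) x_k + a w_k,   w_k = alpha y_k + (1 - alpha) z_k,
      x_{k+1} = (1 - a) x_k + a z_{k+1}.

    The formula for beta_k is exactly the one that makes the first identity
    true ([extrapolation_average]); the second is the definition of z_{k+1} in
    one scheme and of x_{k+1} in the other.

    With these identities both schemes yield the same inequality
    ([one_sequence_step], [two_sequence_step]):

      Phi(x_{k+1}) <= (1 - a) Phi(x_k) + a Phi(xs)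
                      + a^2 / (2 s) (|w_k - xs|^2 - |z_{k+1} - xs|^2)
                      - (a mu / 2) |y_k - xs|^2.

    It is the sum of the descent lemma between y_k and x_{k+1}, of the
    subgradient inequality of f at y_k, tested at x_k with weight 1 - a and at
    xs with weight a (only the latter keeps its quadratic term), and of the
    variational inequality of the proximal map.  The gradient terms cancel, and
    what is left is the three-point identity for w_k, z_{k+1}, xs.  In the
    two-sequence scheme the prox controls g at z_{k+1}, and convexity transfers
    this to x_{k+1}; its step q t = s / a is what matches the factor a^2 / s.

    Multiplying by t^2, the factor of the squared distances becomes 1/2 and
    that of |y_k - xs|^2 becomes alpha / 2.  Since w_k is the average of y_k
    and z_k with weights alpha and 1 - alpha, convexity of the squared norm
    absorbs the last term and leaves (1 - alpha) |z_k - xs|^2, while the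
    recursion on theta bounds (1 - a) t^2 by (1 - alpha) theta_k^2.  So the
    energy without its product weight contracts by 1 - alpha, which is the
    ratio M_k / M_{k+1}: this is [energy_contraction].

    The descent lemma needs no integration: convexity and the Lipschitz bound
    at the two end points give it with L in place of L / 2, and applying a bound with constant C on both
    halves of a segment improves C to C / 2 + L / 4, whose fixed point is
    L / 2 ([descent_halving]). *)

(** * The inner product *)

Section InnerProduct.
Variables (R : realType) (H : completeNormedModType R).
Variables (dot : {dot H for idfun}) (Hdot : induces_norm dot).
Implicit Types (a t : R) (u v w h : H).

Lemma dotC u v : dot u v = dot v u.
Proof. by rewrite hermC expr0 mul1r. Qed.

Lemma dotDr u v w : dot u (v + w) = dot u v + dot u w.
Proof. exact: linearDr. Qed.

Lemma dotZr a u v : dot u (a *: v) = a * dot u v.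
Proof. exact: linearZr_LR. Qed.

Lemma dotNr u v : dot u (- v) = - dot u v.
Proof. exact: linearNr. Qed.

Lemma dotDl u v w : dot (v + w) u = dot v u + dot w u.
Proof. by rewrite !(dotC _ u) dotDr. Qed.

Lemma dotZl a u v : dot (a *: v) u = a * dot v u.
Proof. by rewrite !(dotC _ u) dotZr. Qed.

Lemma dotNl u v : dot (- v) u = - dot v u.
Proof. by rewrite !(dotC _ u) dotNr. Qed.

Definition dotE := (dotDl, dotDr, dotZl, dotZr, dotNl, dotNr).

(** Testing against all vectors turns an identity between linear combinations
    into a ring identity between real numbers. *)
Lemma dot_ext u v : (forall h, dot u h = dot v h) -> u = v.
Proof.
move=> uv; apply/eqP; rewrite -subr_eq0 -normr_eq0 -sqrf_eq0 Hdot.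
by rewrite dotDl dotNl uv subrr.
Qed.

Lemma normsqD u v : `|u + v| ^+ 2 = `|u| ^+ 2 + 2 * dot u v + `|v| ^+ 2.
Proof. by rewrite !Hdot !dotE (dotC v u); ring. Qed.

Lemma normsqZ a u : `|a *: u| ^+ 2 = a ^+ 2 * `|u| ^+ 2.
Proof. by rewrite !Hdot !dotE; ring. Qed.

(** Cauchy-Schwarz; as the norm is already known to satisfy the triangle
    inequality, it is enough to square the latter. *)
Lemma dot_le_norm u v : dot u v <= `|u| * `|v|.
Proof.
have : `|u + v| ^+ 2 <= (`|u| + `|v|) ^+ 2.
  by rewrite ler_pXn2r ?nnegrE ?addr_ge0 ?normr_ge0 // ler_normD.
by rewrite normsqD sqrrD; lra.
Qed.

Lemma normsq_convex (t : R) u v : 0 <= t <= 1 ->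
  `|t *: u + (1 - t) *: v| ^+ 2 <= t * `|u| ^+ 2 + (1 - t) * `|v| ^+ 2.
Proof.
move=> /andP[t0 t1].
have -> : t * `|u| ^+ 2 + (1 - t) * `|v| ^+ 2 =
    `|t *: u + (1 - t) *: v| ^+ 2 + t * (1 - t) * `|u - v| ^+ 2.
  by rewrite !Hdot !dotE (dotC v u); ring.
by rewrite lerDl mulr_ge0 ?sqr_ge0 // mulr_ge0 // subr_ge0.
Qed.

(** * The descent lemma *)

Section Descent.
Variables (f : H -> R) (gradf : H -> H) (L mu : R).
Hypotheses (mu_ge0 : 0 <= mu) (Hf : strongly_convex dot mu f gradf).
Hypothesis Hlip : L.-lipschitz gradf.

Lemma gradient_variation u h :
  dot (gradf (u + h)) h <= dot (gradf u) h + L * `|h| ^+ 2.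
Proof.
have /= := @Hlip (u + h, u) (conj I I).
rewrite addrAC subrr add0r => lip.
rewrite -lerBlDl -dotNl -dotDl (le_trans (dot_le_norm _ _)) //.
by rewrite expr2 mulrA ler_wpM2r.
Qed.

(** Writing the constant as C = L / 2 (1 + 2 ^- n), the induction step
    C |-> C / 2 + L / 4 halves the excess over L / 2. *)
Lemma descent_halving n u h :
  f (u + h) <= f u + dot (gradf u) h + L / 2 * (1 + 2 ^- n) * `|h| ^+ 2.
Proof.
elim: n u h => [|n IHn] u h.
  (* The gradient inequality at u + h, tested at u. *)
  have := Hf (u + h) u; have := gradient_variation u h.
  have -> : u - (u + h) = - h by rewrite opprD addNKr.
  rewrite dotNr expr0 normrN invr1.
  have := mulr_ge0 (divr_ge0 mu_ge0 (ler0n _ 2)) (sqr_ge0 `|h|).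
  by lra.
(* Both halves of the segment, and the change of gradient at its midpoint. *)
have [h2 ->] : exists h2, h = 2 *: h2.
  by exists (2^-1 *: h); rewrite scalerA divff // scale1r.
have -> : u + 2 *: h2 = (u + h2) + h2.
  by apply: dot_ext => w; rewrite !dotE; ring.
have := IHn u h2; have := IHn (u + h2) h2; have := gradient_variation u h2.
rewrite dotZr normsqZ (exprS _ n) invfM.
by lra.
Qed.

Lemma descent u v :
  f v <= f u + dot (gradf u) (v - u) + L / 2 * `|v - u| ^+ 2.
Proof.
set b := L / 2 * _; set a := _ + _.
have ab n : f v <= a + b * 2 ^- n.
  have := descent_halving n u (v - u).
  by rewrite subrKC /a /b; lra.
have cv : (fun n => a + b * 2 ^- n) @ \oo --> a.
  rewrite -[X in _ --> X]addr0 -(mulr0 b).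
  apply: cvgD; first exact: cvg_cst.
  apply: cvgMr.
  under eq_fun do rewrite -exprVn.
  by apply: cvg_expr; rewrite ger0_norm ?invr_ge0 // invf_lt1 // ltr1n.
by apply: (cvgr_to_ge cv); near=> n; exact: ab.
Unshelve. all: end_near.
Qed.
End Descent.

(** * The proximal map *)

Section Prox.
Variable g : H -> \bar R.
Hypotheses (Hproper : proper g) (Hconvex : convex_efun g).

Lemma fineK_edom v : edom g v -> (fine (g v))%:E = g v.
Proof.
move=> gv; rewrite fineK // fin_real //.
by rewrite (Hproper.1 v) gv.
Qed.

Lemma edom_le v r : (g v <= r%:E)%E -> edom g v.
Proof. by move=> gv; rewrite /edom /= (le_lt_trans gv) // ltry. Qed.

Lemma convex_edom u v (t : R) : edom g u -> edom g v -> 0 <= t <= 1 ->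
  edom g (t *: u + (1 - t) *: v) /\
  fine (g (t *: u + (1 - t) *: v)) <= t * fine (g u) + (1 - t) * fine (g v).
Proof.
move=> gu gv t01; have := Hconvex u v t01.
rewrite -(fineK_edom gu) -(fineK_edom gv) -!EFinM -EFinD => guv.
have duv := edom_le guv; split=> //.
by rewrite -lee_fin (fineK_edom duv).
Qed.

(** Used to let t tend to 0 in a first-order optimality argument. *)
Lemma le0_of_le_scaled (a b : R) : 0 <= b ->
  (forall t, 0 < t <= 1 -> a <= t * b) -> a <= 0.
Proof.
move=> b0 ab; rewrite leNgt; apply/negP => a0.
have ab0 : 0 < a + b by rewrite ltr_wpDr.
(* The value t = a / (a + b) already contradicts 0 < a. *)
have := ab (a / (a + b)); rewrite divr_gt0 // ler_pdivrMr // mul1r lerDl b0.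
move=> /(_ isT); rewrite mulrAC ler_pdivlMr // mulrDr gerDr.
by rewrite leNgt mulr_gt0.
Qed.

(** The inequality says that (u - v) / l is a subgradient of g at v.  It follows
    by comparing v with the points t w + (1 - t) v: after division by t, the
    quadratic term in t is the only error, and it vanishes with t. *)
Lemma prox_variational (l : R) u v : 0 < l -> prox l g u v ->
  edom g v /\
  forall w, edom g w -> fine (g v) <= fine (g w) + l^-1 * dot (v - u) (w - v).
Proof.
move=> l0 pv.
have key w : edom g w -> (g v + ((2 * l)^-1 * `|v - u| ^+ 2)%:E <=
   (fine (g w) + (2 * l)^-1 * `|w - u| ^+ 2)%:E)%E.
  by move=> gw; rewrite EFinD fineK_edom.
have dv : edom g v.
  have [w0 gw0] := Hproper.2.
  have := key _ gw0; rewrite -leeBrDr // -EFinB; exact: edom_le.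
split=> // w dw.
have keyr r : edom g r -> fine (g v) + (2 * l)^-1 * `|v - u| ^+ 2 <=
    fine (g r) + (2 * l)^-1 * `|r - u| ^+ 2.
  by move=> /key; rewrite -(fineK_edom dv) -EFinD lee_fin.
rewrite -lerBlDl -subr_le0.
apply: (@le0_of_le_scaled _ ((2 * l)^-1 * `|w - v| ^+ 2)).
  by rewrite mulr_ge0 ?sqr_ge0 // invr_ge0 mulr_ge0 // ltW.
move=> t /andP[t0 t1].
have t01 : 0 <= t <= 1 by rewrite t1 ltW.
have [dr gr] := convex_edom dw dv t01.
have := keyr _ dr.
have -> : t *: w + (1 - t) *: v - u = (v - u) + t *: (w - v).
  by apply: dot_ext => h; rewrite !dotE; ring.
rewrite (normsqD (v - u)) dotZr normsqZ => le1.
rewrite -(ler_pM2l t0) invfM.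
by lra.
Qed.
End Prox.

(** * One iteration *)

Section Step.
Variables (f : H -> R) (gradf : H -> H) (g : H -> \bar R) (L mu s : R).
Hypotheses (mu_ge0 : 0 <= mu) (Hf : strongly_convex dot mu f gradf).
Hypothesis Hlip : L.-lipschitz gradf.
Hypotheses (Hproper : proper g) (Hconvex : convex_efun g).
Hypotheses (s_gt0 : 0 < s) (L_le : L <= s^-1).

Local Notation F v := (f v + fine (g v)).

Lemma descent_step u v :
  f v <= f u + dot (gradf u) (v - u) + s^-1 / 2 * `|v - u| ^+ 2.
Proof.
apply: le_trans (descent mu_ge0 Hf Hlip u v) _.
by rewrite lerD2l ler_wpM2r ?sqr_ge0 // ler_pM2r // invr_gt0.
Qed.

Lemma convex_lower u v : f u + dot (gradf u) (v - u) <= f v.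
Proof.
apply: le_trans (Hf u v); rewrite lerDl mulr_ge0 ?sqr_ge0 //.
by rewrite divr_ge0.
Qed.

Variables (a : R) (x y w u z' xs : H).
Hypotheses (a_gt0 : 0 < a) (a_le1 : a <= 1) (dx : edom g x) (dxs : edom g xs).
Hypothesis yE : y = (1 - a) *: x + a *: w.
Hypothesis uE : u = (1 - a) *: x + a *: z'.

(** The prox inequality at u is tested at x and at xs, with weights 1 - a and a. *)
Lemma one_sequence_step : prox s g (y - s *: gradf y) u ->
  edom g u /\
  F u <= (1 - a) * F x + a * F xs
    + a ^+ 2 / (2 * s) * (`|w - xs| ^+ 2 - `|z' - xs| ^+ 2)
    - a * mu / 2 * `|y - xs| ^+ 2.
Proof.
move=> /(prox_variational Hproper Hconvex s_gt0)[du var]; split=> //.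
have s_neq0 : s != 0 by rewrite gt_eqF.
have dotu v : s^-1 * dot (u - (y - s *: gradf y)) (v - u) =
    s^-1 * dot (u - y) (v - u) + dot (gradf y) (v - u).
  by rewrite !dotE; field.
have gx : (1 - a) * fine (g u) <= (1 - a) * (fine (g x) +
    (s^-1 * dot (u - y) (x - u) + dot (gradf y) (x - u))).
  by rewrite -dotu ler_wpM2l ?var // subr_ge0.
have gxs : a * fine (g u) <= a * (fine (g xs) +
    (s^-1 * dot (u - y) (xs - u) + dot (gradf y) (xs - u))).
  by rewrite -dotu ler_wpM2l ?var // ltW.
have b_ge0 : 0 <= 1 - a by rewrite subr_ge0.
have fx := ler_wpM2l b_ge0 (convex_lower y x).
have fxs := ler_wpM2l (ltW a_gt0) (Hf y xs).
have fu := descent_step y u.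
(* Since (1 - a) x + a xs - y = a (xs - w) and u - y = a (z' - w), this is the
   three-point identity for w, z' and xs. *)
have quad : s^-1 * ((1 - a) * dot (u - y) (x - u) + a * dot (u - y) (xs - u))
    + s^-1 / 2 * `|u - y| ^+ 2 =
    a ^+ 2 / (2 * s) * (`|w - xs| ^+ 2 - `|z' - xs| ^+ 2).
  rewrite uE yE !Hdot !dotE (dotC w x) (dotC z' x) (dotC z' w).
  rewrite (dotC xs w) (dotC xs z').
  by field.
rewrite -quad [`|y - xs|]distrC.
rewrite !(dotDr (gradf y) _ (- _)) !(dotNr (gradf y)) in gx gxs fx fxs fu *.
by lra.
Qed.

(** Here the prox inequality holds at z' and is tested only at xs; convexity of
    g along the segment from x to z' replaces the test at x. *)
Lemma two_sequence_step :
  prox (s / a) g (w - (s / a) *: gradf y) z' ->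
  [/\ edom g z', edom g u &
  F u <= (1 - a) * F x + a * F xs
    + a ^+ 2 / (2 * s) * (`|w - xs| ^+ 2 - `|z' - xs| ^+ 2)
    - a * mu / 2 * `|y - xs| ^+ 2].
Proof.
have sa_gt0 : 0 < s / a by rewrite divr_gt0.
move=> /(prox_variational Hproper Hconvex sa_gt0)[dz' var].
have a01 : 0 <= 1 - a <= 1 by rewrite subr_ge0 a_le1 gerBl ltW.
have [] := convex_edom Hproper Hconvex dx dz' a01.
rewrite subKr -uE => du gu; split=> //.
have s_neq0 : s != 0 by rewrite gt_eqF.
have a_neq0 : a != 0 by rewrite gt_eqF.
have gxs : a * fine (g z') <= a * (fine (g xs) +
    (a / s * dot (z' - w) (xs - z') + dot (gradf y) (xs - z'))).
  apply: ler_wpM2l; first exact: ltW.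
  apply: le_trans (var _ dxs) _; rewrite lerD2l.
  have -> : z' - (w - (s / a) *: gradf y) = (z' - w) + (s / a) *: gradf y.
    by rewrite opprB addrCA addrC.
  rewrite [dot (_ + _ *: _) _]dotDl dotZl mulrDr mulKf ?gt_eqF //.
  by rewrite invf_div.
have b_ge0 : 0 <= 1 - a by rewrite subr_ge0.
have fx := ler_wpM2l b_ge0 (convex_lower y x).
have fxs := ler_wpM2l (ltW a_gt0) (Hf y xs).
have fu := descent_step y u.
have quad : a ^+ 2 / s * dot (z' - w) (xs - z')
    + s^-1 / 2 * `|u - y| ^+ 2 =
    a ^+ 2 / (2 * s) * (`|w - xs| ^+ 2 - `|z' - xs| ^+ 2).
  rewrite uE yE !Hdot !dotE (dotC w x) (dotC z' x) (dotC z' w).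
  rewrite (dotC xs w) (dotC xs z').
  by field.
have lin : dot (gradf y) (u - y) =
    (1 - a) * dot (gradf y) (x - y) + a * dot (gradf y) (z' - y).
  by rewrite [in LHS]uE !dotE; ring.
rewrite -quad [`|y - xs|]distrC.
rewrite lin in fu.
rewrite !(dotDr (gradf y) _ (- _)) !(dotNr (gradf y)) in gxs fx fxs fu *.
by lra.
Qed.
End Step.

(** * Momentum and energy *)

Section Momentum.
Variables (s mu : R) (theta : nat -> R).
Hypotheses (s_gt0 : 0 < s) (mu_ge0 : 0 <= mu) (smu_lt1 : s * mu < 1).
Hypothesis theta_gt0 : forall k, (1 <= k)%N -> 0 < theta k.
Hypothesis theta_le : forall k, (1 <= k)%N -> mu * theta k ^+ 2 <= 1.

Local Notation q := (Num.sqrt s).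
Local Notation step k := (q / theta k).
Local Notation shrink k := (mu * q * theta k).

Let q_gt0 : 0 < q. Proof. by rewrite sqrtr_gt0. Qed.
Let q2E : q ^+ 2 = s. Proof. by rewrite sqr_sqrtr // ltW. Qed.

Lemma shrink_ge0 k : (1 <= k)%N -> 0 <= shrink k.
Proof. by move=> k1; rewrite !mulr_ge0 // ltW ?theta_gt0. Qed.

(** The square of mu q theta_k is (s mu) (mu theta_k ^ 2), a product of a number
    below 1 and one at most 1. *)
Lemma shrink_lt1 k : (1 <= k)%N -> shrink k < 1.
Proof.
move=> k1; rewrite -(@expr_lt1 _ 2) ?shrink_ge0 //.
have -> : shrink k ^+ 2 = s * mu * (mu * theta k ^+ 2).
  by rewrite -[in RHS]q2E; ring.
apply: le_lt_trans smu_lt1; rewrite ler_piMr ?theta_le //.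
by rewrite mulr_ge0 // ltW.
Qed.

Lemma Mcoef_gt0 k : 0 < Mcoef s mu theta k.
Proof.
rewrite /Mcoef big_nat_cond; apply: prodr_gt0 => i /andP[/andP[i1 _] _].
by rewrite invr_gt0 subr_gt0 (mulrC q) shrink_lt1.
Qed.

Lemma McoefS k : Mcoef s mu theta k = (1 - shrink k.+1) * Mcoef s mu theta k.+1.
Proof.
rewrite /Mcoef [in RHS]big_nat_recr //= (mulrC q).
by rewrite [RHS]mulrCA divff ?mulr1 // subr_eq0 gt_eqF // shrink_lt1.
Qed.

(** Both z_k - x_k and x_k - x_{k-1} are multiples of z_k - x_{k-1}, so that
    q (z_k - x_k) = (theta_k - q) (x_k - x_{k-1}).  Hence the extrapolation
    reads (1 - s mu) theta_{k+1} (y_k - x_k) = (1 - alpha) q (z_k - x_k), which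
    is the claim solved for y_k. *)
Lemma extrapolation_average (x y z : nat -> H) :
  x 0%N = x 1%N -> x 1%N = z 1%N -> extrapolation s mu theta x y ->
  (forall k, (1 <= k)%N ->
    x k.+1 = (1 - step k.+1) *: x k + step k.+1 *: z k.+1) ->
  forall k, (1 <= k)%N ->
    y k = (1 - step k.+1) *: x k
          + step k.+1 *: (z k - shrink k.+1 *: (z k - y k)).
Proof.
move=> x01 xz1 ext xS k k1.
have q_neq0 : q != 0 by rewrite gt_eqF.
have th_neq0 j : (1 <= j)%N -> theta j != 0.
  by move=> /theta_gt0 ?; rewrite gt_eqF.
have smu_neq0 : 1 - q ^+ 2 * mu != 0 by rewrite q2E subr_eq0 gt_eqF.
have xz h : (theta k - q) * (dot (x k) h - dot (x k.-1) h) =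
    q * (dot (z k) h - dot (x k) h).
  (* For k = 1 the three points coincide, whatever theta_1 is. *)
  case: k k1 => // -[_|k _] /=; first by rewrite x01 xz1 !subrr !mulr0.
  rewrite xS // !dotE; field; exact: th_neq0.
have yE : y k = x k + beta s mu theta k *: (x k - x k.-1) by exact: ext.
have thS_neq0 := th_neq0 k.+1 isT.
apply: dot_ext => h.
have : (1 - q ^+ 2 * mu) * theta k.+1 * (dot (y k) h - dot (x k) h) =
    (1 - mu * q * theta k.+1) * (q * (dot (z k) h - dot (x k) h)).
  rewrite -xz yE !dotE /beta -[in s * mu]q2E; field.
  by apply/andP.
rewrite !dotE => yz.
apply: (mulfI thS_neq0); apply: subr0_eq.
have := subrr ((1 - q ^+ 2 * mu) * theta k.+1 * (dot (y k) h - dot (x k) h)).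
by rewrite [X in _ - X]yz => <-; field.
Qed.

(** The bound on F (x k.+1) comes from either scheme.  Multiplied by
    theta_{k+1} ^ 2 it compares energies without their product weights, and
    [McoefS] restores the weights. *)
Lemma energy_contraction (F : H -> R) (x y z : nat -> H) (xs : H) k :
  (1 <= k)%N ->
  F xs <= F (x k) ->
  (1 - step k.+1) * theta k.+1 ^+ 2
    <= (1 - q * mu * theta k.+1) * theta k ^+ 2 ->
  F (x k.+1) <= (1 - step k.+1) * F (x k) + step k.+1 * F xs
    + step k.+1 ^+ 2 / (2 * s) *
      (`|z k - shrink k.+1 *: (z k - y k) - xs| ^+ 2 - `|z k.+1 - xs| ^+ 2)
    - step k.+1 * mu / 2 * `|y k - xs| ^+ 2 ->
  Acoef s mu theta k.+1 * (F (x k.+1) - F xs)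
    + Mcoef s mu theta k.+1 / 2 * `|z k.+1 - xs| ^+ 2 <=
  Acoef s mu theta k * (F (x k) - F xs)
    + Mcoef s mu theta k / 2 * `|z k - xs| ^+ 2.
Proof.
move=> k1 Fxs th_step Fstep.
have th_neq0 : theta k.+1 != 0 by rewrite gt_eqF // theta_gt0.
have q_neq0 : q != 0 by rewrite gt_eqF.
set w := z k - _ in Fstep.
have w_convex : `|w - xs| ^+ 2 <=
    shrink k.+1 * `|y k - xs| ^+ 2 + (1 - shrink k.+1) * `|z k - xs| ^+ 2.
  have -> : w - xs = shrink k.+1 *: (y k - xs) + (1 - shrink k.+1) *: (z k - xs).
    by apply: dot_ext => h; rewrite /w !dotE; ring.
  by apply: normsq_convex; rewrite shrink_ge0 //= ltW // shrink_lt1.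
have scaled : theta k.+1 ^+ 2 * (F (x k.+1) - F xs) + `|z k.+1 - xs| ^+ 2 / 2 <=
    (1 - q / theta k.+1) * theta k.+1 ^+ 2 * (F (x k) - F xs)
    + `|w - xs| ^+ 2 / 2 - shrink k.+1 / 2 * `|y k - xs| ^+ 2.
  have := ler_wpM2l (sqr_ge0 (theta k.+1)) Fstep.
  rewrite -subr_ge0 => le; rewrite -subr_ge0; apply: le_trans le _.
  (* The two differences are equal once s is written q ^ 2. *)
  rewrite le_eqVlt; apply/orP; left; apply/eqP.
  by rewrite -[in 2 * s]q2E; field; apply/andP.
have gap : (1 - q / theta k.+1) * theta k.+1 ^+ 2 * (F (x k) - F xs) <=
    (1 - shrink k.+1) * theta k ^+ 2 * (F (x k) - F xs).
  by rewrite ler_wpM2r ?subr_ge0 // (mulrC mu).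
rewrite /Acoef (McoefS k).
have := ler_wpM2l (ltW (Mcoef_gt0 k.+1))
  (le_trans scaled (lerD (lerD gap (lexx _)) (lexx _))).
have := ler_wpM2l (ltW (Mcoef_gt0 k.+1)) w_convex.
by lra.
Qed.

End Momentum.

End InnerProduct.

(** * Monotonicity of the energy and the resulting rate *)

Theorem theorem3p2 (R : realType) (H : completeNormedModType R)
    (dot : {dot H for idfun}) (Hdot : induces_norm dot)
    (f : H -> R) (gradf : H -> H) (g : H -> \bar R) (L mu s : R)
    (Hgrad : is_gradient dot f gradf)
    (HC1 : continuous gradf)
    (Hmu : 0 <= mu)
    (Hf : strongly_convex dot mu f gradf)
    (HL : 0 < L) (HmuL : mu < L)
    (Hlip : L.-lipschitz gradf)
    (Hproper : proper g)
    (Hlsc : lower_semicontinuous g)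
    (Hconvex : convex_efun g)
    (Hs : 0 < s) (HsL : s <= 1 / L)
    (Phi : H -> \bar R) (HPhi : Phi = fun v => ((f v)%:E + g v)%E)
    (xstar : H) (Hxstar : argmin Phi xstar)
    (theta : nat -> R)
    (Htheta_pos : forall k, (1 <= k)%N -> 0 < theta k)
    (Htheta : forall k, (1 <= k)%N ->
      [/\ Num.sqrt s <= theta k,
          mu * theta k ^+ 2 <= 1 &
          (1 - Num.sqrt s / theta k.+1) * theta k.+1 ^+ 2
            <= (1 - Num.sqrt s * mu * theta k.+1) * theta k ^+ 2])
    (x y z : nat -> H)
    (Hscheme : one_sequence_scheme s mu theta g gradf x y z \/
               two_sequence_scheme s mu theta g gradf x y z) :
  let E := energy s mu theta Phi xstar x z in
  (forall k, (1 <= k)%N -> (E k.+1 <= E k)%E) /\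
  (forall k, (1 <= k)%N ->
    (Phi (x k) - Phi xstar <= E 1%N / (Acoef s mu theta k)%:E)%E).
Proof.
pose F v := f v + fine (g v).
have s_ge0 := ltW Hs.
have q_gt0 : 0 < Num.sqrt s by rewrite sqrtr_gt0.
have L_le : L <= s^-1 by rewrite -[L]invrK lef_pV2 ?posrE ?invr_gt0 // -div1r.
have smu_lt1 : s * mu < 1.
  by rewrite mulrC -ltr_pdivlMr // div1r (lt_le_trans HmuL).
have theta_le k : (1 <= k)%N -> mu * theta k ^+ 2 <= 1 by move=> /Htheta[].
(* The minimizer and all x k turn out to lie in the domain of g, where Phi is the
   real-valued F; this is where the extended reals are left. *)
have PhiE v : edom g v -> Phi v = (F v)%:E.
  by move=> gv; rewrite HPhi EFinD fineK_edom.
have PhiN v : ~ edom g v -> Phi v = +oo%E.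
  move=> gv; rewrite HPhi; suff -> : g v = +oo%E by rewrite addey.
  by apply/eqP; rewrite -leye_eq leNgt; apply/negP.
have dxs : edom g xstar.
  apply: contrapT => ndxs; have [v gv] := Hproper.2.
  by have := Hxstar v; rewrite PhiN // PhiE.
have F_min v : edom g v -> F xstar <= F v.
  by move=> gv; have := Hxstar v; rewrite !PhiE.
have a_gt0 k : 0 < Num.sqrt s / theta k.+1 by rewrite divr_gt0 ?Htheta_pos.
have a_le1 k : Num.sqrt s / theta k.+1 <= 1.
  by rewrite ler_pdivrMr ?Htheta_pos // mul1r; have [] := Htheta k.+1 isT.
have dx1 : edom g (x 1%N).
  by case: Hscheme => -[[_ -> ?] _ _].
(* The rest of the argument uses the schemes only through the facts yE and step. *)
pose w k := z k - (mu * Num.sqrt s * theta k.+1) *: (z k - y k).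
have [yE step] : (forall k, (1 <= k)%N ->
    y k = (1 - Num.sqrt s / theta k.+1) *: x k + (Num.sqrt s / theta k.+1) *: w k) /\
  forall k, (1 <= k)%N -> edom g (x k) -> edom g (x k.+1) /\
    F (x k.+1) <= (1 - Num.sqrt s / theta k.+1) * F (x k)
      + Num.sqrt s / theta k.+1 * F xstar
      + (Num.sqrt s / theta k.+1) ^+ 2 / (2 * s) *
        (`|w k - xstar| ^+ 2 - `|z k.+1 - xstar| ^+ 2)
      - Num.sqrt s / theta k.+1 * mu / 2 * `|y k - xstar| ^+ 2.
  case: Hscheme => -[[x01 xz1 _] ext iter].
    have xS k : (1 <= k)%N -> x k.+1 = (1 - Num.sqrt s / theta k.+1) *: x k
        + (Num.sqrt s / theta k.+1) *: z k.+1.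
      move=> k1; have th_neq0 : theta k.+1 != 0 by rewrite gt_eqF ?Htheta_pos.
      have q_neq0 : Num.sqrt s != 0 by rewrite gt_eqF.
      rewrite (iter k k1).2; apply: (dot_ext Hdot) => h.
      by rewrite !dotE; field; apply/andP.
    have yE := extrapolation_average Hdot Hs smu_lt1 Htheta_pos x01 xz1 ext xS.
    split=> // k k1 dxk.
    have [du Fu] := one_sequence_step Hdot Hmu Hf Hlip Hproper Hconvex Hs L_le
      (a_gt0 k) (a_le1 k) dxk dxs (yE k k1) (xS k k1) (iter k k1).1.
    by split.
  have xS k (k1 : (1 <= k)%N) := (iter k k1).2.
  have yE := extrapolation_average Hdot Hs smu_lt1 Htheta_pos x01 xz1 ext xS.
  split=> // k k1 dxk; have := (iter k k1).1.
  have -> : Num.sqrt s * theta k.+1 = s / (Num.sqrt s / theta k.+1).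
    rewrite -{2}(sqr_sqrtr s_ge0).
    by field; rewrite !gt_eqF ?Htheta_pos.
  move=> pz.
  have [_ du Fu] := two_sequence_step Hdot Hmu Hf Hlip Hproper Hconvex Hs L_le
    (a_gt0 k) (a_le1 k) dxk dxs (yE k k1) (xS k k1) pz.
  by split.
have dxk k : (1 <= k)%N -> edom g (x k).
  elim: k => // -[|k] IHk _; first exact: dx1.
  by have [] := step k.+1 isT (IHk isT).
move=> E.
pose e k := Acoef s mu theta k * (F (x k) - F xstar)
  + Mcoef s mu theta k / 2 * `|z k - xstar| ^+ 2.
have EE k : (1 <= k)%N -> E k = (e k)%:E.
  by move=> k1; rewrite /E /energy (PhiE _ (dxk k k1)) (PhiE _ dxs).
have e_dec k : (1 <= k)%N -> e k.+1 <= e k.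
  move=> k1; have [_ Fk] := step k k1 (dxk k k1).
  have [_ _ thk] := Htheta k k1.
  exact: (energy_contraction Hdot Hs Hmu smu_lt1 Htheta_pos theta_le (F := F)
    k1 (F_min _ (dxk k k1)) thk Fk).
have e_le k : (1 <= k)%N -> e k <= e 1%N.
  elim: k => // -[//|k] IHk _.
  exact: le_trans (e_dec k.+1 isT) (IHk isT).
split=> k k1; first by rewrite !EE // lee_fin e_dec.
have M_gt0 := Mcoef_gt0 Hs Hmu smu_lt1 Htheta_pos theta_le k.
have A_gt0 : 0 < Acoef s mu theta k.
  by rewrite mulr_gt0 ?exprn_gt0 ?Htheta_pos.
rewrite (PhiE _ (dxk k k1)) (PhiE _ dxs) EE // inver gt_eqF // -EFinB -EFinM lee_fin.
rewrite ler_pdivlMr // mulrC; apply: le_trans (e_le k k1).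
by rewrite lerDl mulr_ge0 ?sqr_ge0 // divr_ge0 // ltW.
Qed.
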